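(* The degree $D_B$ of a randomly chosen $B$-point in the 2-dimensional hexagonal grid is Poisson distributed with parameter $\lambda_A k A_{tot}/N$, for $A$-point density $\lambda_A$, $k$ connections, a total area $A_{tot}$ and $N=|B|$.
   Context: The model is the $k$-connected $AB$ random geometric graph, with points of type $A$ and points of type $B$. The $A$-points are distributed as a homogeneous Poisson point process with density $\lambda_A$. Every $A$-point connects to the nearest $k$ points of $B$. The degree $D_B$ of a $B$-point is the number of $A$-points connected to it. The $B$-points are placed in a 2-dimensional hexagonal grid, i.e. a regular lattice whose (first-order) Voronoi cells are regular hexagons; $N=|B|$ is the total number of $B$-points in the grid and $A_{tot}$ is the total area of the grid. *)

(* Defs.v *)
(* MathComp-Analysis. *)
From HB Require Import structures.
From mathcomp Require Import all_boot all_order all_algebra.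
From mathcomp Require Import all_classical all_reals all_analysis.
From mathcomp Require Import measurable_realfun.

Set Implicit Arguments.
Unset Strict Implicit.
Unset Printing Implicit Defensive.
Import Order.TTheory GRing.Theory Num.Theory.
Local Open Scope classical_set_scope.
Local Open Scope ring_scope.

Notation plane R := (R * R)%type (only parsing).

Section Geometry.
Context {R : realType}.
Implicit Types (x y b c o u v : plane R) (B H S T Lam : set (plane R)).

Definition area S : \bar R := (lebesgue_measure \x lebesgue_measure)%E S.

(* The norm that the library puts on R * R is the sup norm. *)
Definition eucl_dist x y : R :=
  Num.sqrt ((x.1 - y.1) ^+ 2 + (x.2 - y.2) ^+ 2).

Definition voronoi_cell B b : set (plane R) :=
  [set x | forall b', B b' -> eucl_dist x b <= eucl_dist x b'].

Definition hexagon_vertex c (r theta : R) (j : 'I_6) : plane R :=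
  (c.1 + r * cos (theta + j%:R * pi / 3), c.2 + r * sin (theta + j%:R * pi / 3)).

Definition regular_hexagon S : Prop :=
  exists c (r theta : R), 0 < r /\
    S = [set x | exists w : 'I_6 -> R,
           [/\ forall j, 0 <= w j, \sum_j w j = 1 &
               x = (\sum_j w j * (hexagon_vertex c r theta j).1,
                    \sum_j w j * (hexagon_vertex c r theta j).2)]].

Definition planar_lattice H : Prop :=
  exists o u v, u.1 * v.2 - u.2 * v.1 != 0 /\
    H = [set x | exists m n : int, x = o + u *~ m + v *~ n].

Definition hexagonal_grid H : Prop :=
  planar_lattice H /\ forall h, H h -> regular_hexagon (voronoi_cell H h).

(* Periodic boundary conditions: the plane is wrapped up by the group Lam of
   periods, which are translations preserving the grid H.  The wrapped plane
   R^2 / Lam is represented by a region T containing exactly one point of each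
   Lam-orbit, with the quotient distance pdist. *)
Definition period_group H Lam : Prop :=
  [/\ Lam 0, forall s t, Lam s -> Lam t -> Lam (s - t) &
      forall h s, H h -> Lam s -> H (h + s)].

Definition fundamental_domain Lam T : Prop :=
  measurable T /\ forall x, exists! s, Lam s /\ T (x + s).

Definition pdist Lam x y : R := inf [set eucl_dist x (y + s) | s in Lam].

(* b is one of the k points of B nearest to x for the distance dist: there are
   no k points of B strictly closer to x.  When several points tie for the k-th
   place, all of them are counted as connected. *)
Definition connected_to (dist : plane R -> plane R -> R) B (k : nat) x b : Prop :=
  B b /\ ~~ (`I_k #<= [set b' | B b' /\ dist x b' < dist x b])%card.

End Geometry.

Section Probability.
Context {d : measure_display} {Om : measurableType d} {R : realType}.
Variable P : probability Om R.
Implicit Types (A : Om -> set (plane R)) (S T B : set (plane R)).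

(* The second argument of poisson_prob is a dummy one.  For mu = 0,
   poisson_prob is the Dirac measure at 0 (unlike poisson_pmf). *)
Definition poisson_distributed (D : Om -> \bar R) (mu : R) : Prop :=
  measurable_fun setT D /\
  forall U : set nat,
    P [set w | exists2 n, U n & D w = n%:R%:E] = poisson_prob mu 0 U.

Definition npoints A S (w : Om) : \bar R := counting (A w `&` S).

(* A homogeneous Poisson point process of intensity lambda on T, seen as the
   random set A w of its points. *)
Definition homogeneous_ppp (lambda : R) T A : Prop :=
  [/\ forall w, A w `<=` T,
      forall S, measurable S -> S `<=` T -> (area S < +oo)%E ->
        poisson_distributed (npoints A S) (lambda * fine (area S)) &
      forall (m : nat) (S : 'I_m -> set (plane R)) (n : 'I_m -> nat),
        (forall i, [/\ measurable (S i), S i `<=` T & (area (S i) < +oo)%E]) ->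
        (forall i j, i != j -> S i `&` S j = set0) ->
        P (\bigcap_(i in [set: 'I_m]) [set w | npoints A (S i) w = (n i)%:R%:E]) =
        (\prod_(i < m) P [set w | npoints A (S i) w = (n i)%:R%:E])%E].

Definition process_events T A : set (set Om) :=
  <<s [set E | exists S (n : nat),
         [/\ measurable S, S `<=` T, (area S < +oo)%E &
             E = [set w | npoints A S w = n%:R%:E]] ] >>.

(* J is a uniformly chosen point of the N-point set B, chosen independently of
   the point process A on T. *)
Definition random_site B (N : nat) T A (J : Om -> plane R) : Prop :=
  [/\ forall w, B (J w),
      forall b, B b -> measurable (J @^-1` [set b]),
      forall b, B b -> P (J @^-1` [set b]) = (N%:R^-1)%:E &
      forall b E, B b -> process_events T A E ->
        P (J @^-1` [set b] `&` E) = (P (J @^-1` [set b]) * P E)%E].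

Definition degree A (dist : plane R -> plane R -> R) B (k : nat)
    (b : plane R) (w : Om) : \bar R :=
  counting [set a | A w a /\ connected_to dist B k a b].

End Probability.

(* Main.v *)
Require Import Defs.
From HB Require Import structures.
From mathcomp Require Import all_boot all_order all_algebra.
From mathcomp Require Import all_classical all_reals all_analysis.
From mathcomp Require Import measurable_realfun finmap ring lra.
Import Order.TTheory GRing.Theory Num.Theory.
Local Open Scope classical_set_scope.
Local Open Scope ring_scope.

(** Fix a site b.  The points that connect to b are those of the region S_b of
    all x having fewer than k sites strictly closer than b, so on the event
    J = b the degree is the number of points of the Poisson process in S_b,
    which is Poisson of parameter lambdaA times the area of S_b.  As J is
    independent of the process, the degree of the site J is a mixture of these
    laws ([poisson_mixture], [poisson_degree]), and the theorem amounts to this: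
    all the regions S_b have the same area, k |F|, where F is a cell of the
    lattice L of translations of the grid ([area_region]).

    That area is found by a mass transport argument.  Cut S_b along the
    translates of F and bring the pieces back to F: the area of S_b is the
    integral over x in F of the number of l in L such that x - l lies in S_b
    ([area_unfold]).  By translation invariance, x - l is served by b exactly
    when x is served by the site b + l, and when l varies each site serving x is
    met exactly once ([card_region_translates]).  Hence that number is the
    number of sites serving x; it equals k as soon as no two sites are at
    the same distance from x ([card_lowest]), which excludes only countably
    many lines ([area_ties]).

    All this is done for the grid wrapped up by an arbitrary group Lam of
    periods, of which the unbounded plane is the case where Lam is trivial.
    Two further instances of the same area formula provide the total areas.
    With k = N every point is served by all N sites, so that S_b is the whole
    wrapped plane T and its area is N |F|.  With k = 1 and no periods, S_b is
    the Voronoi cell of b, whose area is therefore |F|. *)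

(** * Cardinals and ranks *)

Lemma counting_card (R : realType) (T : choiceType) (X : set T) n :
  (X #= `I_n)%card -> counting X = n%:R%:E :> \bar R.
Proof.
move=> Xn; have fX : finite_set X by apply/finite_setP; exists n.
by rewrite /counting asboolT// (card_fset_set Xn).
Qed.

Lemma counting_lt_card (R : realType) (T : choiceType) (X : set T) k :
  ((counting X : \bar R) < k%:R%:E)%E = ~~ (`I_k #<= X)%card.
Proof.
have [fX|infX] := pselect (finite_set X).
  have [n Xn] := fX; rewrite (counting_card _ _ _ n)// lte_fin ltr_nat.
  by rewrite (card_le_eqr Xn) card_le_II -ltnNge.
rewrite /counting asboolF// ltNge leey /=; apply/esym/negbTE/negPn.
exact: (card_le_trans (card_leT _)) ((infiniteP _).1 infX).
Qed.

Lemma eq_card_counting (R : realType) (T U : choiceType) (X : set T) (Y : set U) :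
  (X #= Y)%card -> counting X = counting Y :> \bar R.
Proof.
move=> XY; have [fX|infX] := pselect (finite_set X).
  have [n Xn] := fX; rewrite (counting_card _ _ _ n)//.
  by rewrite (counting_card _ _ _ n)// -(card_eql XY).
rewrite /counting !asboolF// => fY; apply: infX.
by rewrite (eq_finite_set XY).
Qed.

(** Existence of a nearest point: a point with the fewest points below it has
    none. *)
Lemma locally_finite_min (R : realType) (T : choiceType) (f : T -> R) (C : set T) :
  (forall r, finite_set [set c | C c /\ f c < r]) -> C !=set0 ->
  exists2 c, C c & forall d, C d -> f c <= f d.
Proof.
move=> finC C0; pose less c := [set d | C d /\ f d < f c].
pose n c := #|` fset_set (less c)|.
have exn : exists m, `[< exists2 c, C c & n c = m >].
  by have [c Cc] := C0; exists (n c); apply/asboolP; exists c.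
case: (ex_minnP exn) => m /asboolP[c Cc ncm] min; exists c => // d Cd.
rewrite leNgt; apply/negP => dc.
have : (n d < n c)%N.
  apply: fproper_ltn_card; rewrite fproperE; apply/andP; split.
    apply/fsubsetP => e; rewrite !in_fset_set; do ?exact: finC.
    move=> /set_mem[Ce ed]; apply/mem_set; split=> //.
    exact: lt_trans ed dc.
  apply/negP => /fsubsetP/(_ d); rewrite !in_fset_set; do ?exact: finC.
  by move=> /(_ (mem_set (conj Cd dc)))/set_mem[]; rewrite ltxx.
by rewrite ncm ltnNge min//; apply/asboolP; exists d.
Qed.

(** When f does not tie, exactly k elements of B have rank less than k.  By
    induction on k: the elements of rank at most k are those of rank less than k
    together with the minimum b of f over the others, because the elements
    below b are exactly those of rank less than k. *)
Lemma card_lowest (R : realType) (T : choiceType) (f : T -> R) (B : set T) k :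
  (forall r, finite_set [set b | B b /\ f b < r]) ->
  (forall b c, B b -> B c -> f b = f c -> b = c) -> (`I_k #<= B)%card ->
  ([set b | B b /\ ~~ (`I_k #<= [set c | B c /\ f c < f b])] #= `I_k)%card.
Proof.
move=> finB injf; pose less b := [set c | B c /\ f c < f b].
elim: k => [_|k IHk kB].
  rewrite [X in (X #= _)%card](_ : _ = set0) ?II0//.
  by apply/seteqP; split=> b //= -[_]; rewrite card_ge0.
pose low := [set b | B b /\ ~~ (`I_k #<= less b)%card].
have IkS : (`I_k #<= `I_k.+1)%card by rewrite card_le_II.
have lowk : (low #= `I_k)%card by apply/IHk/(card_le_trans IkS).
have [b [[Bb nlowb] bmin]] : exists b, (B `\` low) b /\
    forall c, (B `\` low) c -> f b <= f c.
  have [| |b Cb bmin] := @locally_finite_min R T f (B `\` low); last by exists b.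
  - by move=> r; apply: sub_finite_set (finB r) => c /= [[]].
  - apply/set0P/negP => /eqP; rewrite setD_eq0 => Blow.
    have := card_le_trans kB (subset_card_le Blow).
    by rewrite (card_le_eqr lowk) card_le_II ltnn.
have lessb : less b = low.
  apply/seteqP; split=> c.
    move=> [Bc cb]; apply: contrapT => nlowc.
    by move: cb; rewrite ltNge bmin.
  move=> [Bc nc]; split=> //; rewrite ltNge; apply: contraNN nc => bc.
  have /negPn kb : ~~ ~~ (`I_k #<= less b)%card by apply/negP => h; apply: nlowb.
  apply: card_le_trans kb _; apply: subset_card_le => d [Bd db]; split=> //.
  exact: lt_le_trans db bc.
have bU : ([set b] `|` low #= `I_k.+1)%card.
  apply/eq_cardSP; exists b; first by left.
  rewrite setDUl setDv set0U [X in (X #= _)%card](_ : _ = low)//.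
  apply/seteqP; split=> c => [[]|lowc]//.
  by split=> // cb; case: nlowb; rewrite -cb.
(* An element outside of low and different from b is above b and all of low,
   that is above k + 1 elements. *)
rewrite [X in (X #= _)%card](_ : _ = [set b] `|` low)//.
apply/seteqP; split=> c.
  move=> [Bc nc]; have [lowc|nlowc] := pselect (low c); first by right.
  left; apply/esym/injf => //; apply/eqP; rewrite eq_le bmin//= leNgt.
  apply: contraNN nc => bc; rewrite -(card_le_eql bU).
  apply: subset_card_le => d [->//|]; rewrite -lessb => -[Bd db].
  by split=> //; exact: lt_trans db bc.
move=> [->|[Bc nc]]; split=> //.
  by rewrite -/(less b) lessb (card_le_eqr lowk) card_le_II ltnn.
by apply: contraNN nc => /(card_le_trans IkS).
Qed.

Lemma card_nat_enum (T : Type) (L : set T) : (L #= [set: nat])%card ->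
  exists e : nat -> T, injective e /\ range e = L.
Proof.
rewrite card_eq_sym => /card_bijP[f [g fg gf]].
pose i n : [set: nat] := SigSub (mem_setT n).
exists (fun n => val (f (i n))); split.
  by move=> m n /val_inj /(can_inj fg)/(congr1 val).
apply/seteqP; split=> [_ [n _ <-]|y Ly]; first exact/set_mem/valP.
pose ly : L := SigSub (mem_set Ly).
exists (val (g ly)) => //.
have -> : i (val (g ly)) = g ly by exact/val_inj.
by rewrite gf.
Qed.

(** * Area in the plane *)

Section PlaneArea.
Context {R : realType}.
Implicit Types (x t : plane R) (S F Z : set (plane R)).

(** The product measure is stated on a copy of the plane that carries another
    name for the same sigma-algebra; [area] inherits the measure structure for
    the Borel sets of the plane itself. *)
Let leb2 : {measure set (measurableTypeR R * measurableTypeR R) -> \bar R} :=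
  (@lebesgue_measure R \x @lebesgue_measure R)%E.

Let area_semi_sigma_additive :
  semi_sigma_additive (area : set (plane R) -> \bar R).
Proof.
by move=> F mF tF mUF; have := @measure_semi_sigma_additive _ _ _ leb2 F mF tF mUF.
Qed.

HB.instance Definition _ := isMeasure.Build _ (plane R) R area
  (measure0 leb2) (measure_ge0 leb2) area_semi_sigma_additive.

Lemma lebesgue_measure_shift (t : R) (X : set R) : measurable X ->
  lebesgue_measure [set y | X (y + t)] = lebesgue_measure X.
Proof.
move=> mX; apply/esym.
have mf : measurable_fun [set: measurableTypeR R]
    (fun y => y + t : measurableTypeR R).
  have : measurable_fun [set: R] (fun y : R => y + t) by exact: measurable_funD.
  by [].
rewrite (@lebesgue_measure_unique R (pushforward (@lebesgue_measure R)
   (fun y => y + t : measurableTypeR R))) => //.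
move=> _ [[a b] _ <-] /=; rewrite /pushforward.
rewrite (_ : _ @^-1` _ = `]a - t, b - t]%classic); last first.
  by apply/seteqP; split=> x /=; rewrite !in_itv/= ltrBlDr lerBrDr.
rewrite !lebesgue_measure_itv/= !lte_fin ltrD2r -!EFinB.
by rewrite (_ : b - t - (a - t) = b - a)//; ring.
Qed.

Lemma measurable_shift t : measurable_fun [set: plane R] (fun x => x + t).
Proof. by apply: measurable_fun_pair => /=; exact: measurable_funD. Qed.

Lemma shift_measurable t S : measurable S -> measurable [set x | S (x + t)].
Proof.
by move=> mS; have := measurable_shift t measurableT S mS; rewrite setTI.
Qed.

Lemma area_shift t S : measurable S -> area [set x | S (x + t)] = area S.
Proof.
move=> mS; apply/esym.
have mf : measurable_fun [set: measurableTypeR R * measurableTypeR R]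
   (fun x => (x.1 + t.1, x.2 + t.2) : measurableTypeR R * measurableTypeR R).
  by have := measurable_shift t.
rewrite /area (@product_measure_unique _ _ _ _ _ _ _ (pushforward leb2
  (fun x => (x.1 + t.1, x.2 + t.2) : measurableTypeR R * measurableTypeR R)))//.
move=> X Y mX mY.
pose X' : set (measurableTypeR R) := [set y : R | X (y + t.1)].
pose Y' : set (measurableTypeR R) := [set y : R | Y (y + t.2)].
have mX' : measurable X'.
  have : measurable_fun [set: R] (fun y : R => y + t.1) by exact: measurable_funD.
  by move=> /(_ measurableT X mX); rewrite setTI.
have mY' : measurable Y'.
  have : measurable_fun [set: R] (fun y : R => y + t.2) by exact: measurable_funD.
  by move=> /(_ measurableT Y mY); rewrite setTI.
transitivity (leb2 (X' `*` Y')) => //.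
transitivity (lebesgue_measure X' * lebesgue_measure Y')%E.
  exact: product_measure1E.
by congr (_ * _)%E; exact: lebesgue_measure_shift.
Qed.

(** Mass transport.  The translates of F by the e n partition the plane; moving
    the piece of S in each translate back to F superposes all the pieces on F,
    where they cover each point outside of Z exactly c times. *)
Lemma area_unfold (e : nat -> plane R) F S Z (c : \bar R) : (0 <= c)%E ->
  measurable F -> (forall x, exists! n, F (x - e n)) ->
  measurable S -> measurable Z -> area Z = 0%E ->
  (forall x, ~ Z x -> counting [set n | S (x + e n)] = c) ->
  area S = (c * area F)%E.
Proof.
move=> c0 mF Fe mS mZ Z0 Sc.
pose Sn n := [set x | S (x + e n)].
have mSn n : measurable (Sn n) by exact: shift_measurable.
have -> : S = \bigcup_n (S `&` [set x | F (x - e n)]).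
  apply/seteqP; split=> [x Sx|x [n _ []//]].
  by have [n [Fn _]] := Fe x; exists n.
have mFn n : measurable [set x | F (x - e n)] by exact: shift_measurable.
rewrite measure_bigcup//=; last 2 first.
- by move=> n _; exact: measurableI.
- move=> m n _ _ [x [[_ Fm] [_ Fn]]].
  by have [p [_ up]] := Fe x; rewrite -(up m)// -(up n).
transitivity (\sum_(n <oo) \int[area]_(x in F) (\1_(Sn n) x)%:E)%E.
  rewrite [LHS](@eq_eseriesl _ _ xpredT); last by move=> n; rewrite in_setT.
  apply: eq_eseriesr => n _.
  rewrite integral_indic// -(area_shift (e n)); last exact: measurableI.
  by congr area; apply/seteqP; split=> x /=; rewrite addrK; case.
rewrite -integral_nneseries//; last first.
  by move=> n; apply/measurable_EFinP/measurable_indic.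
transitivity (\int[area]_(x in F) c)%E; last first.
  by rewrite integral_cst.
apply: ge0_ae_eq_integral => //.
- apply: ge0_emeasurable_sum => // n _.
  by apply/measurable_EFinP; exact: measurable_indic.
- by move=> x _; exact: nneseries_ge0.
exists Z; split=> // x; apply: contra_notP => nZx _.
by rewrite -(Sc x nZx) counting_dirac.
Qed.

Lemma measurable_linear (a b : R) :
  measurable_fun [set: plane R] (fun x => a * x.1 + b * x.2).
Proof. by apply: measurable_funD; exact: measurable_funM. Qed.

Lemma measurable_line (a b c : R) : measurable [set x | a * x.1 + b * x.2 = c].
Proof.
have mc : measurable ([set c] : set R) by exact: measurable_set1.
by have := measurable_linear a b measurableT _ mc; rewrite setTI.
Qed.

(** A line that is not vertical meets each vertical line in one point; a vertical
    line is the product of a point and the real line. *)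
Lemma area_line (a b c : R) : (a != 0) || (b != 0) ->
  area [set x | a * x.1 + b * x.2 = c] = 0%E.
Proof.
have [->|b0 _] := eqVneq b 0.
  rewrite orbF => a0.
  pose V : set R := [set c / a].
  rewrite [X in area X](_ : _ = V `*` [set: R]); last first.
    apply/seteqP; split=> x /=; rewrite mul0r addr0.
      by move=> h; split=> //; rewrite /V /= -h mulrAC divff// mul1r.
    by case=> -> _; rewrite mulrC divfK.
  transitivity (lebesgue_measure V * lebesgue_measure [set: R])%E.
    by apply: product_measure1E => //; exact: measurable_set1.
  by rewrite lebesgue_measure_set1 mul0e.
rewrite /area /product_measure1 integral0_eq// => y _ /=.
rewrite [X in lebesgue_measure X](_ : _ = [set (c - a * y) / b]).
  exact: lebesgue_measure_set1.
apply/seteqP; split=> z; rewrite /xsection /=.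
  by move=> /set_mem/= <-; rewrite addrAC subrr add0r mulrAC divff// mul1r.
by move=> ->; apply/mem_set => /=; rewrite [b * _]mulrC divfK// addrC subrK.
Qed.

Lemma area_box_lty (S : set (plane R)) (M : R) : measurable S ->
  (forall x, S x -> `|x.1| <= M /\ `|x.2| <= M) -> (area S < +oo)%E.
Proof.
move=> mS SM; pose I : set R := `[- M, M]%classic.
have mI : measurable I by exact: measurable_itv.
apply: (@le_lt_trans _ _ (area (I `*` I))).
  have mII : measurable (I `*` I) by exact: measurableX.
  apply: le_measure; [exact/mem_set|exact/mem_set|].
  by move=> x /SM[x1 x2]; split; rewrite /I /= in_itv/= -ler_norml.
rewrite (_ : area _ = lebesgue_measure I * lebesgue_measure I)%E; last first.
  exact: product_measure1E.
by rewrite lebesgue_measure_itv/=; case: ifP => _; rewrite ?mul0e -?EFinM ltry.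
Qed.

End PlaneArea.

(** * Lattices *)

Section EuclideanDistance.
Context {R : realType}.
Implicit Types (x y z t p q : plane R).

Lemma eucl_dist_shift t x y : eucl_dist (x + t) (y + t) = eucl_dist x y.
Proof.
rewrite /eucl_dist; congr (Num.sqrt (_ ^+ 2 + _ ^+ 2)).
  by transitivity (x.1 + t.1 - (y.1 + t.1)) => //; ring.
by transitivity (x.2 + t.2 - (y.2 + t.2)) => //; ring.
Qed.

Lemma eucl_dist_ge0 x y : 0 <= eucl_dist x y. Proof. exact: sqrtr_ge0. Qed.

Lemma dist1_le_eucl_dist x y : `|x.1 - y.1| <= eucl_dist x y.
Proof. by rewrite -sqrtr_sqr ler_wsqrtr// lerDl sqr_ge0. Qed.

Lemma dist2_le_eucl_dist x y : `|x.2 - y.2| <= eucl_dist x y.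
Proof. by rewrite -sqrtr_sqr ler_wsqrtr// lerDr sqr_ge0. Qed.

(** The points equidistant from p and q form the perpendicular bisector of p and
    q, which is a line. *)
Lemma eucl_dist_eq x p q : (eucl_dist x p = eucl_dist x q) <->
  2 * (q.1 - p.1) * x.1 + 2 * (q.2 - p.2) * x.2 =
  q.1 ^+ 2 + q.2 ^+ 2 - p.1 ^+ 2 - p.2 ^+ 2.
Proof.
have ge0 y : 0 <= (x.1 - y.1) ^+ 2 + (x.2 - y.2) ^+ 2.
  by rewrite addr_ge0 ?sqr_ge0.
have e : (x.1 - p.1) ^+ 2 + (x.2 - p.2) ^+ 2 -
    ((x.1 - q.1) ^+ 2 + (x.2 - q.2) ^+ 2) =
    2 * (q.1 - p.1) * x.1 + 2 * (q.2 - p.2) * x.2 -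
    (q.1 ^+ 2 + q.2 ^+ 2 - p.1 ^+ 2 - p.2 ^+ 2) by ring.
rewrite /eucl_dist; split=> /eqP.
  by rewrite eqr_sqrt// -subr_eq0 e subr_eq0 => /eqP.
by rewrite -subr_eq0 -e subr_eq0 => /eqP ->.
Qed.

Lemma measurable_eucl_dist y : measurable_fun [set: plane R] (eucl_dist ^~ y).
Proof.
apply: (@measurableT_comp _ _ _ _ _ _ (@Num.sqrt R)).
  by apply: continuous_measurable_fun; exact: sqrt_continuous.
by apply: measurable_funD; apply: measurable_funX; exact: measurable_funB.
Qed.

End EuclideanDistance.

Section Lattice.
Context {R : realType}.
Implicit Types (x y z t u v : plane R).

Definition lattice u v : set (plane R) :=
  [set x | exists m n : int, x = u *~ m + v *~ n].

Lemma lattice0 u v : lattice u v 0.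
Proof. by exists 0, 0; rewrite !mulr0z addr0. Qed.

Lemma latticeB u v x y : lattice u v x -> lattice u v y -> lattice u v (x - y).
Proof.
move=> [m [n ->]] [m' [n' ->]]; exists (m - m'), (n - n').
by rewrite !mulrzBr opprD addrACA.
Qed.

Lemma fst_mulrz x (m : int) : (x *~ m).1 = m%:~R * x.1.
Proof. by rewrite mulrzl -(raddfMz fst). Qed.

Lemma snd_mulrz x (m : int) : (x *~ m).2 = m%:~R * x.2.
Proof. by rewrite mulrzl -(raddfMz snd). Qed.

(** The coordinates of x in the basis (u, v), by Cramer's rule. *)
Definition lat_coord1 u v x := (x.1 * v.2 - x.2 * v.1) / (u.1 * v.2 - u.2 * v.1).
Definition lat_coord2 u v x := (u.1 * x.2 - u.2 * x.1) / (u.1 * v.2 - u.2 * v.1).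

Section Basis.
Variables u v : plane R.
Hypothesis uv : u.1 * v.2 - u.2 * v.1 != 0.

Lemma lat_coordD1 x m n :
  lat_coord1 u v (x + (u *~ m + v *~ n)) = lat_coord1 u v x + m%:~R.
Proof. by rewrite /lat_coord1/= !fst_mulrz !snd_mulrz; field. Qed.

Lemma lat_coordD2 x m n :
  lat_coord2 u v (x + (u *~ m + v *~ n)) = lat_coord2 u v x + n%:~R.
Proof. by rewrite /lat_coord2/= !fst_mulrz !snd_mulrz; field. Qed.

Lemma lat_coordE1 x : x.1 = lat_coord1 u v x * u.1 + lat_coord2 u v x * v.1.
Proof. by rewrite /lat_coord1 /lat_coord2; field. Qed.

Lemma lat_coordE2 x : x.2 = lat_coord1 u v x * u.2 + lat_coord2 u v x * v.2.
Proof. by rewrite /lat_coord1 /lat_coord2; field. Qed.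

Lemma lat_coord1_lat m n : lat_coord1 u v (u *~ m + v *~ n) = m%:~R.
Proof.
rewrite -[X in lat_coord1 _ _ X]add0r lat_coordD1 /lat_coord1.
by rewrite !mul0r subrr mul0r add0r.
Qed.

Lemma lat_coord2_lat m n : lat_coord2 u v (u *~ m + v *~ n) = n%:~R.
Proof.
rewrite -[X in lat_coord2 _ _ X]add0r lat_coordD2 /lat_coord2.
by rewrite !mulr0 subrr mul0r add0r.
Qed.

Definition parallelogram : set (plane R) :=
  [set x | [/\ 0 <= lat_coord1 u v x, lat_coord1 u v x < 1,
    0 <= lat_coord2 u v x & lat_coord2 u v x < 1]].

Lemma lat_inj m n m' n' : u *~ m + v *~ n = u *~ m' + v *~ n' -> (m, n) = (m', n').
Proof.
move=> h; congr pair; apply: (@intr_inj R).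
  by rewrite -(lat_coord1_lat m n) h lat_coord1_lat.
by rewrite -(lat_coord2_lat m n) h lat_coord2_lat.
Qed.

Lemma card_lattice : (lattice u v #= [set: nat])%card.
Proof.
pose f (p : int * int) := u *~ p.1 + v *~ p.2.
have -> : lattice u v = [set f p | p in [set: int * int]].
  apply/seteqP; split=> [x [m [n ->]]|x [[m n] _ <-]]; last by exists m, n.
  by exists (m, n).
rewrite (card_eql (inj_card_eq _)); last first.
  by move=> [m n] [m' n'] _ _; exact: lat_inj.
apply/eq_card_nat; first exact: countableP.
have infZ : infinite_set [set: int].
  apply: (@sub_infinite_set _ (range Posz)) => //.
  rewrite (eq_finite_set (inj_card_eq _)); first exact: infinite_nat.
  by move=> m n _ _ [].
by rewrite -setXTT; exact: infinite_setX.
Qed.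

Lemma measurable_lat_coord1 : measurable_fun setT (lat_coord1 u v).
Proof.
by apply: measurable_funM => //; apply: measurable_funB; exact: measurable_funM.
Qed.

Lemma measurable_lat_coord2 : measurable_fun setT (lat_coord2 u v).
Proof.
by apply: measurable_funM => //; apply: measurable_funB; exact: measurable_funM.
Qed.

Lemma measurable_parallelogram : measurable parallelogram.
Proof.
have mI : measurable (`[0, 1[%classic : set R) by exact: measurable_itv.
have -> : parallelogram = lat_coord1 u v @^-1` `[0, 1[%classic
    `&` lat_coord2 u v @^-1` `[0, 1[%classic.
  apply/seteqP; split=> x; rewrite /parallelogram /= !in_itv/=.
    by move=> [-> -> -> ->].
  by move=> [/andP[-> ->] /andP[-> ->]].
apply: measurableI.
  by have := measurable_lat_coord1 measurableT _ mI; rewrite setTI.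
by have := measurable_lat_coord2 measurableT _ mI; rewrite setTI.
Qed.

Lemma area_parallelogram_lty : (area parallelogram < +oo)%E.
Proof.
apply: (@area_box_lty _ _ (`|u.1| + `|v.1| + (`|u.2| + `|v.2|))).
  exact: measurable_parallelogram.
have bound (a b c d : R) : 0 <= a -> a < 1 -> 0 <= b -> b < 1 ->
    `|a * c + b * d| <= `|c| + `|d|.
  move=> a0 a1 b0 b1; apply: le_trans (ler_normD _ _) _.
  by rewrite !normrM (ger0_norm a0) (ger0_norm b0) lerD// ler_piMl// ltW.
move=> x [a0 a1 b0 b1]; split.
  by rewrite lat_coordE1 (le_trans (bound _ _ _ _ _ _ _ _))// lerDl addr_ge0.
by rewrite lat_coordE2 (le_trans (bound _ _ _ _ _ _ _ _))// lerDr addr_ge0.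
Qed.

(** The only lattice translation that brings x into the parallelogram subtracts
    the integer parts of its two coordinates. *)
Lemma lattice_fundamental_domain : fundamental_domain (lattice u v) parallelogram.
Proof.
split=> [|x]; first exact: measurable_parallelogram.
exists (u *~ - Num.floor (lat_coord1 u v x) + v *~ - Num.floor (lat_coord2 u v x)).
split.
  split; first by do 2 eexists.
  have bound (a : R) : 0 <= a - (Num.floor a)%:~R /\ a - (Num.floor a)%:~R < 1.
    by rewrite subr_ge0 floor_le ltrBlDl -intrD1 floorD1_gt.
  have [? ?] := bound (lat_coord1 u v x); have [? ?] := bound (lat_coord2 u v x).
  by rewrite /parallelogram /= lat_coordD1 lat_coordD2 !mulrNz.
move=> _ [[m [n ->]]]; rewrite /parallelogram /= lat_coordD1 lat_coordD2.
have uniq (a : R) (i : int) : 0 <= a + i%:~R -> a + i%:~R < 1 -> - Num.floor a = i.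
  move=> a0 a1; rewrite -[RHS]opprK; congr (- _); apply: floor_def.
  by rewrite intrD1 mulrNz; apply/andP; split; lra.
by move=> [? ? ? ?]; rewrite (uniq _ m)// (uniq _ n).
Qed.

Lemma finite_int_bounded (C : R) : finite_set [set m : int | `|m%:~R| <= C].
Proof.
pose M := (Num.bound C).+1.
apply: (@sub_finite_set _ _ ((Posz @` `I_M) `|` ((fun n => - Posz n) @` `I_M))).
  move=> i /= iC.
  have ib : (`|i|%N < M)%N.
    rewrite ltnS -(ler_nat R) (le_trans _ (ltW (archi_boundP _)))//; last first.
      exact: le_trans iC.
    by rewrite natr_absz intr_norm.
  have [i0|i0] := leP 0 i; [left|right]; exists `|i|%N => //.
    by rewrite gez0_abs.
  by rewrite ltz0_abs// opprK.
by rewrite finite_setU; split; exact/finite_image/finite_II.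
Qed.

(** A point of the lattice close to x has bounded Cartesian coordinates, hence
    bounded coordinates in the basis (u, v), and these are integers. *)
Lemma lattice_locally_finite x (r : R) :
  finite_set [set l | lattice u v l /\ eucl_dist x l < r].
Proof.
pose c1 := `|x.1| + r; pose c2 := `|x.2| + r.
pose D := `|u.1 * v.2 - u.2 * v.1|.
pose C1 := (c1 * `|v.2| + c2 * `|v.1|) / D.
pose C2 := (`|u.1| * c2 + `|u.2| * c1) / D.
pose f (p : int * int) := u *~ p.1 + v *~ p.2.
have finI := finite_setX (finite_int_bounded C1) (finite_int_bounded C2).
apply: sub_finite_set (finite_image f finI) => _ [[m [n ->]]].
set l := u *~ m + v *~ n => ler.
have l1 : `|l.1| <= c1.
  have := dist1_le_eucl_dist x l; have := ler_dist_dist l.1 x.1.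
  rewrite /c1; have := ler_normB l.1 x.1.
  have := ler_norm (`|l.1| - `|x.1|).
  by rewrite (distrC x.1); lra.
have l2 : `|l.2| <= c2.
  have := dist2_le_eucl_dist x l; have := ler_dist_dist l.2 x.2.
  rewrite /c2; have := ler_norm (`|l.2| - `|x.2|).
  by rewrite (distrC x.2); lra.
have D0 : 0 < D by rewrite normr_gt0.
exists (m, n) => //; split=> /=.
  rewrite -(lat_coord1_lat m n) -/l /lat_coord1 normrM normfV ler_pM2r ?invr_gt0//.
  by rewrite (le_trans (ler_normB _ _))// !normrM lerD// ler_wpM2r.
rewrite -(lat_coord2_lat m n) -/l /lat_coord2 normrM normfV ler_pM2r ?invr_gt0//.
by rewrite (le_trans (ler_normB _ _))// !normrM lerD// ler_wpM2l.
Qed.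

End Basis.
End Lattice.

(** * The region served by a site of a wrapped grid *)

(** The grid is H = o + L for a countable, locally finite group L of
    translations.  It is wrapped up by a subgroup Lam of L, and B is the set of
    the sites of the wrapped grid. *)
Section WrappedGrid.
Context {R : realType}.
Implicit Types (x y z t : plane R).
Variables (L Lam T : set (plane R)) (o : plane R).
Hypothesis L0 : L 0.
Hypothesis LB : forall s t, L s -> L t -> L (s - t).
Hypothesis Lfin : forall x r, finite_set [set l | L l /\ eucl_dist x l < r].
Hypothesis Lnat : (L #= [set: nat])%card.
Hypothesis Lam0 : Lam 0.
Hypothesis LamB : forall s t, Lam s -> Lam t -> Lam (s - t).
Hypothesis LamL : Lam `<=` L.
Hypothesis domT : fundamental_domain Lam T.

Let LN s : L s -> L (- s). Proof. by move=> Ls; rewrite -sub0r; exact: LB. Qed.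
Let LD s t : L s -> L t -> L (s + t).
Proof. by move=> Ls Lt; rewrite -[t]opprK; apply/LB/LN. Qed.
Let LamN s : Lam s -> Lam (- s).
Proof. by move=> Ls; rewrite -sub0r; exact: LamB. Qed.
Let LamD s t : Lam s -> Lam t -> Lam (s + t).
Proof. by move=> Ls Lt; rewrite -[t]opprK; apply/LamB/LamN. Qed.

Let H : set (plane R) := [set y | L (y - o)].
Let B := H `&` T.

Let HD y l : H y -> L l -> H (y + l).
Proof. by move=> Hy Ll; rewrite /H /= addrAC; exact: LD. Qed.

(** The representative in T of the orbit of x under Lam, which exists and is
    unique because T is a fundamental domain; 0 is a default value. *)
Definition rep x : plane R := xget 0 [set y | T y /\ Lam (y - x)].

Lemma repP x : T (rep x) /\ Lam (rep x - x).
Proof.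
have [s [[Ls Ts] _]] := domT.2 x.
apply: (@xgetPex _ 0 [set y | T y /\ Lam (y - x)]).
by exists (x + s); rewrite /= addrAC subrr add0r.
Qed.

Lemma rep_unique x y : T y -> Lam (y - x) -> y = rep x.
Proof.
move=> Ty Lyx; have [Tr Lr] := repP x; have [s [_ us]] := domT.2 x.
have e z : x + (z - x) = z by rewrite addrC subrK.
have sy : s = y - x by apply: us; rewrite e.
have sr : s = rep x - x by apply: us; rewrite e.
by rewrite -(e y) -sy sr e.
Qed.

Lemma rep_mod x y : Lam (x - y) -> rep x = rep y.
Proof.
move=> Lxy; have [Tr Lr] := repP x; apply: rep_unique => //.
by rewrite -(subrK x (rep x)) -addrA; exact: LamD.
Qed.

Lemma rep_inv x y : rep x = rep y -> Lam (x - y).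
Proof.
move=> e; have [_ Lx] := repP x; have [_ Ly] := repP y.
have -> : x - y = (rep y - y) - (rep x - x) by rewrite e opprB [RHS]addrC subrKA.
exact: LamB.
Qed.

Lemma rep_id x : T x -> rep x = x.
Proof. by move=> Tx; apply/esym/rep_unique; rewrite ?subrr. Qed.

Let H_rep y : H y -> B (rep y).
Proof.
move=> Hy; have [Tr Lr] := repP y; split=> //.
by rewrite -(subrK y (rep y)) addrC; apply: HD => //; exact: LamL.
Qed.

(** By local finiteness the infimum in [pdist] is a minimum, so that ties for
    [pdist] come from ties for the Euclidean distance. *)
Lemma pdist_attained x y : exists2 s, Lam s &
  pdist Lam x y = eucl_dist x (y + s) /\
  forall t, Lam t -> pdist Lam x y <= eucl_dist x (y + t).
Proof.
have [||s Ls smin] := @locally_finite_min R _ (fun s => eucl_dist x (y + s)) Lam.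
- move=> r; apply: sub_finite_set (Lfin (x - y) r) => s /= [Ls sr]; split.
    exact: LamL.
  by rewrite -(eucl_dist_shift y) subrK addrC.
- by exists 0.
have e : pdist Lam x y = eucl_dist x (y + s).
  apply/eqP; rewrite eq_le; apply/andP; split.
    apply: ge_inf; last by exists s.
    by exists 0 => _ [t _ <-]; exact: eucl_dist_ge0.
  apply: lb_le_inf; first by exists (eucl_dist x (y + s)), s.
  by move=> _ [t Lt <-]; exact: smin.
by exists s => //; split=> // t Lt; rewrite e; exact: smin.
Qed.

Lemma pdist_period x y s : Lam s -> pdist Lam x (y + s) = pdist Lam x y.
Proof.
move=> Ls; rewrite /pdist; congr inf; apply/seteqP; split=> _ [t Lt <-].
  by exists (s + t); [exact: LamD|rewrite addrA].
by exists (t - s); [exact: LamB|rewrite addrCA -addrA subrr addr0 addrC].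
Qed.

Lemma pdist_shift t x y : pdist Lam (x + t) (y + t) = pdist Lam x y.
Proof.
rewrite /pdist; congr inf; apply/seteqP; split=> _ [s Ls <-]; exists s => //.
  by rewrite addrAC eucl_dist_shift.
by rewrite addrAC eucl_dist_shift.
Qed.

Lemma pdist_rep x y : pdist Lam x (rep y) = pdist Lam x y.
Proof.
have [_ Lr] := repP y; rewrite -(subrK y (rep y)) addrC.
exact: pdist_period.
Qed.

(** The sites within distance r of x on the wrapped plane are representatives of
    sites within distance r of x in the plane. *)
Lemma pdist_locally_finite x r : finite_set [set b | B b /\ pdist Lam x b < r].
Proof.
have fin : finite_set [set h | H h /\ eucl_dist x h < r].
  apply: sub_finite_set (finite_image (+%R^~ o) (Lfin (x - o) r)) => h [Hh hr].
  exists (h - o); last by rewrite subrK.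
  by split=> //; rewrite -(eucl_dist_shift o) !subrK.
apply: sub_finite_set (finite_image rep fin) => b [[Hb Tb]].
have [s Ls [-> _]] := pdist_attained x b => sr.
exists (b + s); first by split=> //; apply: HD => //; exact: LamL.
rewrite -(rep_id b Tb); apply: rep_mod.
by rewrite (rep_id b Tb) addrAC subrr add0r.
Qed.

(** Translation by l permutes the sites of the wrapped grid, by c |-> rep (c + l),
    and preserves [pdist], hence the number of sites closer than a given one. *)
Lemma connected_to_shift k x b l : B b -> L l ->
  connected_to (pdist Lam) B k (x + l) (rep (b + l)) <->
  connected_to (pdist Lam) B k x b.
Proof.
move=> Bb Ll; have Bbl : B (rep (b + l)) by apply/H_rep/HD => //; case: Bb.
have e c : pdist Lam (x + l) (rep (c + l)) = pdist Lam x c.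
  by rewrite pdist_rep pdist_shift.
have -> : connected_to (pdist Lam) B k (x + l) (rep (b + l)) =
   (B (rep (b + l)) /\
    ~~ (`I_k #<= [set c | B c /\ pdist Lam x c < pdist Lam x b])%card).
  rewrite /connected_to; congr (_ /\ ~~ _); apply/card_le_eqr.
  rewrite [X in (X #= _)%card](_ : _ = [set rep (c + l) | c in
     [set c | B c /\ pdist Lam x c < pdist Lam x b]]); last first.
    apply/seteqP; split=> c.
      move=> [Bc]; rewrite e => cb.
      have ec : rep (rep (c - l) + l) = c.
        rewrite -[RHS](rep_id c); last by case: Bc.
        apply: rep_mod; have [_] := repP (c - l).
        by rewrite opprB addrA.
      exists (rep (c - l)) => //; split.
        by apply/H_rep/HD; [case: Bc|exact: LN].
      by rewrite -e ec.
    move=> [c' [Bc' cb] <-]; split; rewrite /= ?e//.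
    by apply/H_rep/HD => //; case: Bc'.
  apply: inj_card_eq => c c' /set_mem[[_ Tc] _] /set_mem[[_ Tc'] _] /rep_inv.
  rewrite opprD addrACA subrr addr0 => /rep_mod.
  by rewrite !rep_id.
by rewrite /connected_to; split=> [[_ ?]|[_ ?]]; split.
Qed.

(** The ties are those of the whole unwrapped grid, so that this null set depends
    neither on Lam nor on a site. *)
Definition ties : set (plane R) :=
  [set x | exists p q, [/\ H p, H q, p <> q & eucl_dist x p = eucl_dist x q]].

Let enum : exists2 e : nat -> plane R, injective e &
  forall y, H y <-> exists n, y = o + e n.
Proof.
have [e [e2 e3]] := card_nat_enum _ _ Lnat.
have e1 n : L (e n) by rewrite -e3; exists n.
exists e => //.
move=> y; split.
  by rewrite /H /= -e3 => -[n _ en]; exists n; rewrite en addrC subrK.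
by move=> [n ->]; rewrite /H /= addrAC subrr add0r; exact: e1.
Qed.

Let tieline (p q : plane R) : set (plane R) :=
  [set x | 2 * (q.1 - p.1) * x.1 + 2 * (q.2 - p.2) * x.2 =
  q.1 ^+ 2 + q.2 ^+ 2 - p.1 ^+ 2 - p.2 ^+ 2].

Let tiesE : exists e : nat -> plane R,
  ties = \bigcup_m \bigcup_n
    (if e m == e n then set0 else tieline (o + e m) (o + e n)).
Proof.
have [e ei eH] := enum; exists e; apply/seteqP; split=> x.
  move=> [_ [_ [/eH[m ->] /eH[n ->] pq /eucl_dist_eq xl]]].
  exists m => //; exists n => //; case: eqP => // emn.
  by case: pq; rewrite emn.
move=> [m _ [n _]]; case: eqP => // emn /eucl_dist_eq xl.
exists (o + e m), (o + e n); split=> //.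
- by apply/eH; exists m.
- by apply/eH; exists n.
- by move/addrI.
Qed.

Let measurable_tieline p q : measurable (tieline p q).
Proof. exact: measurable_line. Qed.

Lemma measurable_ties : measurable ties.
Proof.
have [e ->] := tiesE; apply: bigcup_measurable => m _.
by apply: bigcup_measurable => n _; case: ifP.
Qed.

Lemma area_ties : area ties = 0%E.
Proof.
have [e te] := tiesE.
apply/(negligibleP _ measurable_ties); rewrite te.
apply: negligible_bigcup => m; apply: negligible_bigcup => n.
case: eqP => [_|emn]; first exact: negligible_set0.
apply/negligibleP => //; apply: area_line.
apply: contra_notT emn; rewrite negb_or !negbK => /andP[].
rewrite !mulf_eq0 !pnatr_eq0/= !subr_eq0 => /eqP h1 /eqP h2.
by apply/esym/(addrI o)/eqP; rewrite -pair_eqE /pair_eq /= h1 h2 !eqxx.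
Qed.

Lemma pdist_inj x b c : ~ ties x -> B b -> B c ->
  pdist Lam x b = pdist Lam x c -> b = c.
Proof.
move=> nx [Hb Tb] [Hc Tc].
have [s Ls [-> _]] := pdist_attained x b; have [t Lt [-> _]] := pdist_attained x c.
move=> e; have [st|st] := pselect (b + s = c + t); last first.
  case: nx; exists (b + s), (c + t); split=> //.
    by apply: HD => //; exact: LamL.
  by apply: HD => //; exact: LamL.
rewrite -(rep_id b Tb) -(rep_id c Tc); apply: rep_mod.
have -> : b - c = t - s.
  by apply/eqP; rewrite subr_eq addrAC eq_sym subr_eq eq_sym st addrC.
exact: LamB.
Qed.

Section Region.
Variables (k : nat) (b : plane R).
Hypothesis kB : (`I_k #<= B)%card.
Hypothesis Bb : B b.

Definition region : set (plane R) :=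
  [set x | T x /\ connected_to (pdist Lam) B k x b].

(** Off the ties, l |-> rep (b + l) maps the translations l for which x - l is
    served by b bijectively onto the sites serving x.  It is injective because
    two such l with equal images differ by a period, while both points x - l lie
    in T.  It is onto because the points x - (c - b) + s, for s in Lam, are the
    candidates x - l with b + l in the orbit of c, and one of them lies in T. *)
Lemma card_region_translates x : ~ ties x ->
  ([set l | L l /\ region (x - l)] #= `I_k)%card.
Proof.
move=> nx.
have low : ([set c | connected_to (pdist Lam) B k x c] #= `I_k)%card.
  apply: card_lowest => //.
    exact: pdist_locally_finite.
  by move=> c c'; exact: pdist_inj.
rewrite -(card_eql (A := [set rep (b + l) | l in [set l | L l /\ region (x - l)]])).
  rewrite [X in (X #= _)%card](_ : _ =
    [set c | connected_to (pdist Lam) B k x c])//.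
  apply/seteqP; split=> c.
    move=> [l [Ll [Txl]]] /(connected_to_shift _ _ _ _ Bb Ll).
    by rewrite subrK => ? <-.
  move=> cc; have [[Hc Tc] _] := cc.
  have [Tr Lr] := repP (x - (c - b)).
  set s := rep (x - (c - b)) - (x - (c - b)) in Lr.
  have Ll : L (c - b - s).
    apply: LB; last exact: LamL.
    have -> : c - b = (c - o) - (b - o) by rewrite opprB addrA subrK.
    by apply: LB => //; case: Bb.
  have xl : x - (c - b - s) = rep (x - (c - b)).
    by rewrite opprB addrCA /s subrK.
  have rc : rep (b + (c - b - s)) = c.
    rewrite -[RHS](rep_id c)//; apply: rep_mod.
    by rewrite addrA [b + _]addrC subrK addrAC subrr add0r; exact: LamN.
  exists (c - b - s) => //; split=> //; split; first by rewrite xl.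
  by apply/(connected_to_shift _ _ _ _ Bb Ll); rewrite subrK rc.
apply: inj_card_eq => l l' /set_mem[Ll [Tl _]] /set_mem[Ll' [Tl' _]] /rep_inv.
rewrite opprD addrACA subrr add0r => ll'.
have : x - l' = x - l.
  rewrite -(rep_id _ Tl) -(rep_id _ Tl'); apply: rep_mod.
  by rewrite opprB addrC subrKA.
by move/addrI/oppr_inj.
Qed.

(** Being less than r for a minimum over a countable set is a countable union of
    conditions on Euclidean distances. *)
Lemma measurable_pdist y : measurable_fun setT (pdist Lam ^~ y).
Proof.
have [e ei eH] := enum.
apply: (measurability _ (RGenInftyO.measurableE R)) => // _ [_ [r ->] <-].
rewrite setTI [X in measurable X](_ : _ = \bigcup_n
   (if `[< Lam (e n) >] then [set x | eucl_dist x (y + e n) < r] else set0)).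
  apply: bigcup_measurable => n _; case: ifP => // _.
  have mI : measurable (`]-oo, r[%classic : set R) by exact: measurable_itv.
  have := measurable_eucl_dist (y + e n) measurableT _ mI; rewrite setTI.
  by congr measurable; apply/seteqP; split=> x; rewrite /= in_itv.
apply/seteqP; split=> x; rewrite /= in_itv/=.
  have [s Ls [-> _]] := pdist_attained x y => sr.
  have /eH[n] : H (o + s) by rewrite /H /= addrAC subrr add0r; exact: LamL.
  by move/addrI => sn; exists n => //; rewrite -sn; case: asboolP.
move=> [n _]; case: asboolP => // Le /= er.
have [s Ls [_ smin]] := pdist_attained x y.
exact: le_lt_trans (smin _ Le) er.
Qed.

(** The number of sites closer to x than b is a countable sum of indicators, hence
    a measurable function of x. *)
Lemma measurable_region : measurable region.
Proof.
have [e ei eH] := enum.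
pose E n := if `[< B (o + e n) >] then
  [set x | pdist Lam x (o + e n) < pdist Lam x b] else set0.
have mE n : measurable (E n).
  rewrite /E; case: ifP => // _.
  have := measurable_fun_ltr (measurable_pdist (o + e n)) (measurable_pdist b).
  have mt : measurable [set true] by [].
  by move=> /(_ measurableT _ mt); rewrite setTI.
pose f x : \bar R := (\sum_(n <oo) (\1_(E n) x)%:E)%E.
have mf : measurable_fun setT f.
  apply: ge0_emeasurable_sum => // n _.
  by apply/measurable_EFinP; exact: measurable_indic.
have fE x : f x = counting [set c | B c /\ pdist Lam x c < pdist Lam x b].
  transitivity (counting [set n | E n x] : \bar R); first by rewrite counting_dirac.
  apply: eq_card_counting; rewrite card_eq_sym.
  rewrite [X in (X #= _)%card](_ : _ = [set o + e n | n in [set n | E n x]]).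
    by apply: inj_card_eq => m n _ _ /addrI/ei.
  apply/seteqP; split=> c.
    move=> [Bc cb]; have [/eH[n cn] _] := Bc; exists n => //=.
    by rewrite /E -cn; case: asboolP.
  by move=> [n /=]; rewrite /E; case: asboolP => // Bn nb <-.
have -> : region = T `&` [set x | (f x < k%:R%:E)%E].
  apply/seteqP; split=> x; rewrite /region /= fE counting_lt_card.
    by move=> [Tx [_ ?]].
  by move=> [Tx ?].
apply: measurableI; first exact: domT.1.
by have := emeasurable_fun_infty_o measurableT mf k%:R%:E; rewrite setTI.
Qed.

(** By [area_unfold], the translates x - l that land in the region being k in
    number for almost every x. *)
Lemma area_region F : fundamental_domain L F -> area region = (k%:R%:E * area F)%E.
Proof.
move=> domF.
have [e [e2 e3]] := card_nat_enum _ _ Lnat.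
have e1 n : L (e n) by rewrite -e3; exists n.
have e4 l : L l -> exists n, e n = l by rewrite -e3 => -[n _ <-]; exists n.
(* The translates of F by L are also indexed by the opposites of the e n. *)
apply: (@area_unfold R e F region ties).
- by rewrite lee_fin.
- exact: domF.1.
- move=> x; have [s [[Ls Fs] us]] := domF.2 x.
  have [n en] := e4 _ (LN _ Ls).
  exists n; split=> [|m Fm]; first by rewrite en opprK.
  have sm : s = - e m by apply: us; split=> //; exact: LN.
  by apply: e2; rewrite en sm opprK.
- exact: measurable_region.
- exact: measurable_ties.
- exact: area_ties.
move=> x /card_region_translates h; apply: counting_card.
rewrite -(card_eqr h) card_eq_sym.
rewrite [X in (X #= _)%card](_ : _ = [set - e n | n in [set n | region (x + e n)]]).
  by apply: inj_card_eq => m n _ _ /oppr_inj/e2.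
apply/seteqP; split=> l.
  move=> [Ll rl]; have [n en] := e4 _ (LN _ Ll).
  by exists n; rewrite /= en ?opprK.
by move=> [n rn <-]; split; [exact: LN|rewrite opprK].
Qed.

End Region.
End WrappedGrid.

(** * Poisson counts at a random site *)

Section Mixture.
Context {d : measure_display} {Om : measurableType d} {R : realType}.
Variables (P : probability Om R) (lambda : R) (T : set (plane R)).
Variables (A : Om -> set (plane R)) (J : Om -> plane R).
Variables (W : set (plane R)) (N : nat).
Hypothesis ppp : homogeneous_ppp P lambda T A.
Hypothesis site : random_site P W N T A J.

Let event (X : Om -> \bar R) (U : set nat) :=
  [set w | exists2 n, U n & X w = n%:R%:E].

Let eventE X U : event X U = \bigcup_(n in U) [set w | X w = n%:R%:E].
Proof. by apply/seteqP; split=> w [n Un]; exists n. Qed.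

(** Independence of the site is assumed for the events of the point process only,
    hence this lemma. *)
Lemma npoints_event S U : measurable S -> S `<=` T -> (area S < +oo)%E ->
  process_events T A (event (npoints A S) U).
Proof.
move=> mS ST Soo; rewrite eventE bigcup_mkcond.
apply: sigma_algebra_bigcup => n; case: ifP => _; last exact: sigma_algebra0.
by apply: sub_sigma_algebra; exists S, n.
Qed.

Let measurable_event X U : measurable_fun setT X -> measurable (event X U).
Proof.
move=> mX; rewrite eventE; apply: bigcup_measurable => n _.
have m1 : measurable [set n%:R%:E : \bar R] by exact: emeasurable_set1.
by have := mX measurableT _ m1; rewrite setTI.
Qed.

Lemma site_partition (X : plane R -> Om -> \bar R) (Q : set (\bar R)) :
  [set w | Q (X (J w) w)] =
  \bigcup_(b in W) (J @^-1` [set b] `&` [set w | Q (X b w)]).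
Proof.
have [JW _ _ _] := site.
apply/seteqP; split=> w; first by move=> Qw; exists (J w).
by move=> [b Wb [/= -> ]].
Qed.

(** A count in a region that depends on the random site is a mixture of the counts
    in the regions of the sites; if these regions have equal areas, the mixed
    laws are all the same Poisson law and their weights add up to 1. *)
Lemma poisson_mixture (S : plane R -> set (plane R)) (a : R) : finite_set W ->
  (forall b, W b -> [/\ measurable (S b), S b `<=` T & area (S b) = a%:E]) ->
  poisson_distributed P (fun w => npoints A (S (J w)) w) (lambda * a).
Proof.
move=> finW SW; have [_ Apois _] := ppp; have [JW mJ PJ indep] := site.
have pois b : W b -> poisson_distributed P (npoints A (S b)) (lambda * a).
  move=> /SW[mS ST Sa]; have -> : a = fine (area (S b)) by rewrite Sa.
  by apply: Apois => //; rewrite Sa ltry.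
split=> [_ Y mY|U].
  rewrite setTI [X in measurable X](site_partition (fun b => npoints A (S b)) Y).
  apply: fin_bigcup_measurable => // b Wb; apply: measurableI; first exact: mJ.
  by have := (pois b Wb).1 measurableT _ mY; rewrite setTI.
rewrite [X in P X](site_partition (fun b => npoints A (S b))
  [set y | exists2 n, U n & y = n%:R%:E]).
have disj (E : plane R -> set Om) : trivIset W (fun b => J @^-1` [set b] `&` E b).
  by move=> b c _ _ [w [[/= <- _] [/= <- _]]].
rewrite measure_fin_bigcup//; last first.
  move=> b Wb; apply: measurableI; first exact: mJ.
  by apply: measurable_event; exact: (pois b Wb).1.
transitivity (\sum_(b \in W) P (J @^-1` [set b]) * poisson_prob (lambda * a) 0 U)%E.
  apply: eq_fsbigr => b /set_mem Wb; have [mS ST Sa] := SW b Wb.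
  rewrite -(pois b Wb).2; apply: indep => //; apply: npoints_event => //.
  by rewrite Sa ltry.
rewrite -ge0_mule_fsuml//.
rewrite -[RHS]mul1e; congr (_ * _)%E.
have UJ : \bigcup_(b in W) J @^-1` [set b] = setT.
  by apply/seteqP; split=> // w _; exists (J w).
rewrite -measure_fin_bigcup//; first by rewrite UJ; exact: probability_setT.
by move=> b c _ _ [w [/= <- <-]].
Qed.

Lemma poisson_degree (dist : plane R -> plane R -> R) (B : set (plane R)) k a :
  (W #= `I_N)%card ->
  (forall b, W b -> measurable [set x | T x /\ connected_to dist B k x b] /\
     area [set x | T x /\ connected_to dist B k x b] = a%:E) ->
  poisson_distributed P (fun w => degree A dist B k (J w) w) (lambda * a).
Proof.
move=> WN Wa; have [AT _ _] := ppp.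
have finW : finite_set W by apply/finite_setP; exists N.
pose S b := [set x | T x /\ connected_to dist B k x b].
rewrite (_ : (fun w => _) = (fun w => npoints A (S (J w)) w)).
  by apply: poisson_mixture => // b /Wa[mS aS]; split=> // x [].
apply/funext => w; rewrite /degree /npoints; congr counting.
apply/seteqP; split=> x [Ax] => [xJ|[]//].
by split=> //; split=> //; exact: AT Ax.
Qed.

(** A probability space is not empty, so the random site takes some value. *)
Lemma random_site_neq0 : (W #= `I_N)%card -> N != 0.
Proof.
have [JW _ _ _] := site => WN; apply/eqP => N0.
have W0 : W = set0.
  by apply/eqP; rewrite -(card_eq0 (U := nat)) (card_eql WN) N0 II0.
have : P setT = 0%E.
  rewrite (_ : setT = set0) ?measure0//; apply/seteqP; split=> // w _.
  by have := JW w; rewrite W0.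
by rewrite [LHS]probability_setT => /eqP; rewrite onee_eq0.
Qed.

End Mixture.

(** * The wrapped plane and the unbounded plane *)

Section Instances.
Context {R : realType}.
Implicit Types (x y z t : plane R) (W H Lam T : set (plane R)).

Lemma card_lt1 (U : Type) (X : set U) : ~~ (`I_1 #<= X)%card <-> X = set0.
Proof.
split=> [X1|->]; last first.
  rewrite card_le0; apply/eqP => e.
  by have : `I_1 0%N by []; rewrite e.
apply/eqP/negPn; apply: contraNN X1 => /set0P[x Xx].
rewrite -(card_le_eql (@card_set1 _ x)); apply: subset_card_le.
by move=> _ ->.
Qed.

Lemma pdist_trivial : pdist [set 0] = @eucl_dist R.
Proof.
apply/funext => x; apply/funext => y.
by rewrite /pdist image_set1 inf1 addr0.
Qed.

Lemma fundamental_domain_trivial : fundamental_domain [set 0] [set: plane R].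
Proof. by split=> // x; exists 0; split=> // s [->]. Qed.

Lemma connected_to1 H b : H b ->
  [set x | connected_to (@eucl_dist R) H 1 x b] = voronoi_cell H b.
Proof.
move=> Hb; apply/seteqP; split=> x /=.
  move=> [_ /card_lt1 x0] c Hc; rewrite leNgt; apply/negP => cb.
  by have : set0 c by rewrite -x0.
move=> vx; split=> //; apply/card_lt1/seteqP; split=> // c [Hc].
by rewrite ltNge vx.
Qed.

(** At most N - 1 of the N sites are closer than b, since b itself is not. *)
Lemma connected_to_all (dist : plane R -> plane R -> R) B N x b :
  (B #= `I_N)%card -> B b -> connected_to dist B N x b.
Proof.
move=> BN Bb; split=> //; apply/negP => NX.
have [m Bm] : finite_set (B `\ b).
  by apply: finite_setD; apply/finite_setP; exists N.
have BSm : (B #= `I_m.+1)%card by apply/eq_cardSP; exists b.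
have Nm : N = m.+1 by apply/card_eq_II; rewrite -(card_eql BN).
have sub : [set c | B c /\ dist x c < dist x b] `<=` B `\ b.
  by move=> c [Bc cb]; split=> // cE; move: cb; rewrite cE ltxx.
have := card_le_trans NX (subset_card_le sub).
by rewrite (card_le_eqr Bm) Nm card_le_II ltnn.
Qed.

Lemma area_setD0 (S Z : set (plane R)) : measurable S -> measurable Z ->
  area Z = 0%E -> area (S `\` Z) = area S.
Proof.
move=> mS mZ Z0.
have mD : measurable (S `\` Z) by exact: measurableD.
have mI : measurable (S `&` Z) by exact: measurableI.
rewrite -[in RHS](setUIDK S Z) setUC measureU0//.
by apply: (subset_measure0 mI mZ) => // x [].
Qed.

End Instances.

Section LatticeGrid.
Context {R : realType}.
Variables (o u v : plane R).
Hypothesis uv : u.1 * v.2 - u.2 * v.1 != 0.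
Implicit Types (W Lam T : set (plane R)).
Let L := lattice u v.
Let H := [set y | L (y - o)].
Let cell : R := fine (area (parallelogram u v)).

Let LB s t : L s -> L t -> L (s - t). Proof. exact: latticeB. Qed.
Let Lfin := lattice_locally_finite u v uv.
Let Lnat := card_lattice u v uv.

Let area_parallelogramE : area (parallelogram u v) = cell%:E.
Proof. by rewrite fineK// ge0_fin_numE//; exact: area_parallelogram_lty. Qed.

Lemma lattice_region Lam T k b : Lam 0 ->
  (forall s t, Lam s -> Lam t -> Lam (s - t)) -> Lam `<=` L ->
  fundamental_domain Lam T -> (`I_k #<= H `&` T)%card -> (H `&` T) b ->
  measurable (region L Lam T o k b) /\
  area (region L Lam T o k b) = (k%:R * cell)%:E.
Proof.
move=> Lam0 LamB LamL domT kB Bb; split.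
  exact: (measurable_region L Lam T o Lfin Lnat Lam0 LamL domT).
rewrite EFinM -area_parallelogramE.
apply: (area_region L Lam T o) => //; first exact: lattice0.
exact: lattice_fundamental_domain.
Qed.

(** This is the area of a region in the case k = N: it is then all of T. *)
Lemma area_fundamental_domain Lam T N : Lam 0 ->
  (forall s t, Lam s -> Lam t -> Lam (s - t)) -> Lam `<=` L ->
  fundamental_domain Lam T -> (H `&` T #= `I_N)%card -> N != 0 ->
  area T = (N%:R * cell)%:E.
Proof.
move=> Lam0 LamB LamL domT BN N0.
have [b Bb] : H `&` T !=set0.
  apply/set0P; apply: contra_neqN N0 => /eqP B0.
  by apply/card_eq_II; rewrite -(card_eql BN) B0 II0.
have NB : (`I_N #<= H `&` T)%card by rewrite (card_le_eqr BN).
have [_ <-] := lattice_region _ _ _ _ Lam0 LamB LamL domT NB Bb.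
congr area; apply/seteqP; split=> [x Tx|x []//].
by split=> //; exact: connected_to_all.
Qed.

Let Lam0B : forall s t : plane R, [set 0] s -> [set 0] t -> [set 0] (s - t).
Proof. by move=> s t -> ->; rewrite /= subrr. Qed.

Let Lam0L : [set 0] `<=` L. Proof. by move=> _ ->; exact: lattice0. Qed.

Lemma plane_region k b : H b ->
  measurable [set x | connected_to (@eucl_dist R) H k x b] /\
  area [set x | connected_to (@eucl_dist R) H k x b] = (k%:R * cell)%:E.
Proof.
move=> Hb.
have kH : (`I_k #<= H `&` setT)%card.
  rewrite setIT (_ : H = [set l + o | l in L]); last first.
    apply/seteqP; split=> [y Hy|_ [l Ll <-]]; last by rewrite /H /= addrK.
    by exists (y - o) => //; rewrite subrK.
  rewrite (card_le_eqr (inj_card_eq _)); last by move=> x y _ _ /addIr.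
  by rewrite (card_le_eqr Lnat) card_leT.
have Hb' : (H `&` setT) b by rewrite setIT.
have := lattice_region _ _ _ _ erefl Lam0B Lam0L fundamental_domain_trivial kH Hb'.
rewrite (_ : region _ _ _ _ _ _ = [set x | connected_to (@eucl_dist R) H k x b])//.
rewrite /region pdist_trivial -/H setIT.
by apply/seteqP; split=> x /=; [case|].
Qed.

(** The Voronoi cell of a site is the set of the points served by it when k = 1.
    Distinct cells only share ties, so their areas add up. *)
Lemma area_voronoi_cells W N : W `<=` H -> (W #= `I_N)%card ->
  area (\bigcup_(b in W) voronoi_cell H b) = (N%:R * cell)%:E.
Proof.
move=> WH WN; have finW : finite_set W by apply/finite_setP; exists N.
have vor b : W b ->
    measurable (voronoi_cell H b) /\ area (voronoi_cell H b) = cell%:E.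
  move=> /WH Hb; rewrite -[cell]mul1r.
  by have := plane_region 1 b Hb; rewrite connected_to1.
pose Z := ties L o.
have mZ : measurable Z by exact: measurable_ties.
have Z0 : area Z = 0%E by exact: area_ties.
rewrite -(area_setD0 _ Z)//; last first.
  by apply: fin_bigcup_measurable => // b /vor[].
rewrite setD_bigcupl measure_fin_bigcup//=; last 2 first.
- move=> p q Wp Wq [x [[vp nZ] [vq _]]]; apply: contra_notP nZ => pq.
  exists p, q; split=> //; [exact: WH|exact: WH|].
  by apply/eqP; rewrite eq_le vp ?vq//; exact: WH.
- by move=> b /vor[mb _]; exact: measurableD.
transitivity (\sum_(b \in W) cell%:E)%E.
  by apply: eq_fsbigr => b /set_mem/vor[mb <-]; rewrite area_setD0.
rewrite fsumEFin// fsbig_finite//= big_const_seq count_predT.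
by rewrite (card_fset_set WN) iter_addr addr0 mulr_natl.
Qed.

End LatticeGrid.

Theorem theorem2 (R : realType) (d : measure_display) (Om : measurableType d)
    (P : probability Om R) (lambdaA : R) (k N : nat) (H : set (plane R))
    (A : Om -> set (plane R)) (J : Om -> plane R) :
  0 < lambdaA -> (0 < k)%N -> hexagonal_grid H ->
  (* finite grid of N points and total area (area T), without boundary:
     the opposite sides of T are identified *)
  (forall Lam T B : set (plane R),
     period_group H Lam -> fundamental_domain Lam T ->
     B = H `&` T -> (B #= `I_N)%card -> (k <= N)%N ->
     homogeneous_ppp P lambdaA T A -> random_site P B N T A J ->
     poisson_distributed P
       (fun w => degree A (pdist Lam) B k (J w) w)
       (lambdaA * k%:R * fine (area T) / N%:R)) /\
  (* N grid points observed in the unbounded grid, with their total area *)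
  (forall W : set (plane R),
     W `<=` H -> (W #= `I_N)%card ->
     homogeneous_ppp P lambdaA setT A -> random_site P W N setT A J ->
     poisson_distributed P
       (fun w => degree A eucl_dist H k (J w) w)
       (lambdaA * k%:R * fine (area (\bigcup_(b in W) voronoi_cell H b)) / N%:R)).
Proof.
move=> _ _ [[c [u [v [uv HE]]]] _].
have {HE}-> : H = [set y | lattice u v (y - c)].
  rewrite HE; apply/seteqP; split=> y /=.
    by move=> [m [n ->]]; exists m, n; rewrite addrC !addrA addNr add0r.
  by move=> [m [n e]]; exists m, n; rewrite -addrA -e addrC subrK.
set H' := [set y | _].
split=> [Lam T B [Lam0 LamB HLam] domT BE BN kN ppp site|W WH WN ppp site].
  have LamL : Lam `<=` lattice u v.
    move=> s Ls; have : H' (c + s).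
      by apply: HLam => //; rewrite /H' /= subrr; exact: lattice0.
    by rewrite /H' /= addrAC subrr add0r.
  have Nn0 := random_site_neq0 _ _ _ _ _ _ site BN.
  subst B; rewrite (area_fundamental_domain c u v uv Lam T N)//.
  rewrite (_ : _ / _ =
    lambdaA * (k%:R * fine (area (parallelogram u v)))); last first.
    by rewrite /=; field; rewrite pnatr_eq0.
  apply: (poisson_degree P lambdaA T A J (H' `&` T) N) => // b Bb.
  apply: (lattice_region c u v uv Lam T k b) => //.
  by rewrite (card_le_eqr BN) card_le_II.
have Nn0 := random_site_neq0 _ _ _ _ _ _ site WN.
rewrite (area_voronoi_cells c u v uv W N)//.
rewrite (_ : _ / _ =
  lambdaA * (k%:R * fine (area (parallelogram u v)))); last first.
  by rewrite /=; field; rewrite pnatr_eq0.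
apply: (poisson_degree P lambdaA setT A J W N) => // b Wb.
rewrite (_ : [set x | _] = [set x | connected_to eucl_dist H' k x b]).
  exact: (plane_region c u v uv k b (WH _ Wb)).
by apply/seteqP; split=> x /=; [case|].
Qed.
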